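(* Let $p$ be an odd prime, and let $e = p^r+1$ for some positive integer $r$. In $\mathbb{F}_{p^{2r}}$, the cyclotomic numbers of order $2e$ are as follows. If $p^r-1 \equiv 0 \pmod 4$, then \[ (0,0)_{2e} = \frac{p^r-5}{4},\qquad (0,e)_{2e} = (e,0)_{2e} = (e,e)_{2e} = \frac{p^r-1}{4}. \] If $p^r-1 \equiv 2 \pmod 4$, then \[ (0,e)_{2e} = \frac{p^r+1}{4},\qquad (0,0)_{2e} = (e,0)_{2e} = (e,e)_{2e} = \frac{p^r-3}{4}. \] In both cases, \[ (0,i)_{2e} = (i,0)_{2e} = (i,i)_{2e} = (i,e)_{2e} = (e,i)_{2e} = (i,e+i)_{2e} = (e+i,i)_{2e} = 0 \quad\text{for } i \notin \{0,e\}. \] For all $i,j$ with $1\le i,j\le e-1$ and $i\neq j$, exactly one of the four cyclotomic numbers \[ (i,j)_{2e},\quad (i,j+e)_{2e},\quad (i+e,j)_{2e},\quad (i+e,j+e)_{2e} \] is $1$ and the other three are $0$.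
   Context: Let $\alpha$ be a generator of $\mathbb{F}_{p^{2r}}^*$ and, for $i$ modulo $2e$, let $C_i^H=\{\alpha^t : t\equiv i\pmod{2e}\}$ be the cosets of the subgroup of $2e$-th powers (note $2e=2(p^r+1)$ divides $p^{2r}-1$). The cyclotomic number of order $2e$ is $(i,j)_{2e}=|(C_i^H+1)\cap C_j^H|$, where $C_i^H+1=\{c+1:c\in C_i^H\}$; indices are taken in $\{0,1,\dots,2e-1\}$, read modulo $2e$. *)

(* Defs.v *)
From HB Require Import structures.
From mathcomp Require Import all_boot all_order all_algebra all_fingroup all_solvable all_field.

Set Implicit Arguments.
Unset Strict Implicit.
Unset Printing Implicit Defensive.

Import GRing.Theory.
Local Open Scope ring_scope.

(* { alpha ^ t : t = i mod N }.  The exponents are cut off at #|F| to get a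
   finite set; when N divides the order of alpha this loses nothing, see
   cyclotomic_classP. *)
Definition cyclotomic_class (F : finFieldType) (alpha : {unit F}) (N i : nat)
    : {set F} :=
  [set val alpha ^+ t | t : 'I_#|F| & (t == i %[mod N])%N].

Definition cyclotomic_number (F : finFieldType) (alpha : {unit F})
    (N i j : nat) : nat :=
  #|[set c + 1 | c in cyclotomic_class alpha N i]
    :&: cyclotomic_class alpha N j|.

Lemma cyclotomic_classP (F : finFieldType) (alpha : {unit F}) (N i : nat)
    (x : F) :
  (N %| #[alpha]%g)%N ->
  reflect (exists2 t : nat, (t = i %[mod N])%N & x = val alpha ^+ t)
          (x \in cyclotomic_class alpha N i).
Proof.
move=> dvdN; apply: (iffP imsetP) => [[t]|[t tE ->]].
  by rewrite inE => /eqP tE ->; exists t.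
have lt_ord : (t %% #[alpha]%g < #|F|)%N.
  apply: leq_trans (ltn_pmod t (order_gt0 alpha)) _.
  apply: leq_trans (max_card _) _.
  by rewrite card_sub max_card.
exists (Ordinal lt_ord); first by rewrite inE /= modn_dvdm // tE.
by rewrite /= -!FinRing.val_unitX expg_mod_order.
Qed.

(* Main.v *)
Require Import Defs.
From HB Require Import structures.
From mathcomp Require Import all_boot all_order all_algebra all_fingroup all_solvable all_field.
From mathcomp Require Import zify ring.

(** Write q = p ^ r = 2h + 1, so that the multiplicative group of F is cyclic
    of order (q - 1)(q + 1) = (2e) h.  Membership in a class then becomes an
    equation: x lies in C_i if and only if x ^ h = alpha ^ (i h)
    ([cyclotomic_classE]), and a cyclotomic number counts the x for which
    x ^ h and (x + 1) ^ h take prescribed values.  Since alpha ^ (e h) = -1,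
    passing from i to i + e changes the sign of the prescribed value, and
    C_i together with C_(i+e) is the set x ^ (q - 1) = beta_i, where
    beta_i = alpha ^ (2 i h).  This is the punctured line through alpha ^ i
    over the subfield of order q.

    As q is a power of the characteristic, x |-> x ^ q is additive.  If x is
    on the line beta and x + 1 on the line gamma, comparing the two expressions
    for (x + 1) ^ q gives the linear equations
        x (beta - gamma) = gamma - 1,   (x + 1) (beta - gamma) = beta - 1
    ([line_shift]).  As x and x + 1 are nonzero, as soon as two of beta, gamma,
    1 are equal all three are, which yields all the vanishing numbers.  When
    the three are distinct, x = (gamma - 1) / (beta - gamma) is a solution
    ([card_line_shift]), the geometric content being that 1 has exactly one
    decomposition along two distinct lines; as it is unique, precisely one of
    the four sign choices contains it.

    There remain the indices 0 and e, that is, the counts N a b of the x with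
    x ^ h = a and (x + 1) ^ h = b for a, b = 1, -1: quadratic residues in the
    subfield.  Three facts determine them.  The involution x |-> 1 / x shows
    N (-1) 1 = N (-1) (-1); the involution x |-> - 1 - x swaps the two
    conditions up to the sign (-1) ^ h; and N a 1 + N a (-1) is the number h of
    solutions of x ^ h = a, less one if x = -1 is among them. *)

Section PowerClasses.

Set Implicit Arguments.
Unset Strict Implicit.
Import GRing.Theory.
Local Open Scope ring_scope.

(** * Cyclotomic classes as fibres of a power map *)

Lemma generator_prim_root (F : finFieldType) (alpha : {unit F}) :
  generator [set: {unit F}] alpha -> (#|F|.-1).-primitive_root (val alpha).
Proof.
move=> /eqP gen_alpha.
have ordA : #[alpha]%g = #|F|.-1 by rewrite -card_finField_unit gen_alpha.
have ord_gt0 := order_gt0 alpha.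
rewrite /primitive_root_of_unity -{1}ordA ord_gt0 /=.
apply/forallP => i; apply/eqP.
rewrite unity_rootE -FinRing.val_unitX -FinRing.val_unit1 (inj_eq val_inj).
rewrite -order_dvdn ordA; apply/idP/eqP => [/dvdn_leq|->//].
by move=> /(_ isT) le_i; apply/eqP; rewrite eqn_leq ltn_ord.
Qed.

(** The h-th power map has kernel the N-th powers, so its fibres are exactly the
    cosets of that subgroup. *)
Lemma cyclotomic_classE (F : finFieldType) (alpha : {unit F}) (N h i : nat) :
  generator [set: {unit F}] alpha -> #|F|.-1 = (N * h)%N ->
  cyclotomic_class alpha N i = [set x | x ^+ h == val alpha ^+ (i * h)].
Proof.
move=> gen_alpha cardF.
have z_prim := generator_prim_root gen_alpha.
have ordA : #[alpha]%g = #|F|.-1.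
  by move/eqP: gen_alpha => gen_alpha; rewrite -card_finField_unit gen_alpha.
have /andP[N_gt0 h_gt0] : (0 < N)%N && (0 < h)%N.
  by rewrite -muln_gt0 -cardF (prim_order_gt0 z_prim).
apply/setP => x; rewrite inE.
have dvdN : (N %| #[alpha]%g)%N by rewrite ordA cardF dvdn_mulr.
apply/(cyclotomic_classP _ _ dvdN)/eqP => [[t tE ->]|xE].
  rewrite -exprM; apply/eqP; rewrite (eq_prim_root_expr z_prim) cardF.
  by rewrite -!muln_modl tE.
have /(prim_rootP z_prim)[t xt] : x ^+ #|F|.-1 = 1.
  rewrite cardF mulnC exprM xE -exprM -mulnA (mulnC h) -cardF mulnC exprM.
  by rewrite (prim_expr_order z_prim) expr1n.
exists t => //; apply/eqP; rewrite -(eqn_pmul2r h_gt0) !muln_modl -cardF.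
by rewrite -(eq_prim_root_expr z_prim) exprM -xt xE.
Qed.

Definition shifted_power_count (F : finFieldType) (h : nat) (a b : F) : nat :=
  #|[set x : F | (x ^+ h == a) && ((x + 1) ^+ h == b)]|.

Lemma cyclotomic_numberE (F : finFieldType) (alpha : {unit F}) (N h i j : nat) :
  generator [set: {unit F}] alpha -> #|F|.-1 = (N * h)%N ->
  cyclotomic_number alpha N i j
    = shifted_power_count h (val alpha ^+ (i * h)) (val alpha ^+ (j * h)).
Proof.
move=> gen_alpha cardF; rewrite /cyclotomic_number.
rewrite !(cyclotomic_classE _ gen_alpha cardF).
rewrite -[RHS](card_imset _ (addIr (1 : F))); apply: eq_card => y.
rewrite inE; apply/andP/imsetP => [[/imsetP[x]]|[x]].
  by rewrite !inE => xi -> xj; exists x => //; rewrite inE xi.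
by rewrite !inE => /andP[xi xj] ->; split => //; apply: imset_f; rewrite inE.
Qed.

Lemma card_expr_eq (F : finFieldType) (h : nat) (z w : F) :
  h.-primitive_root z -> w != 0 -> #|[set x | x ^+ h == w ^+ h]| = h.
Proof.
move=> z_prim w_neq0; rewrite -[RHS]card_ord.
have inj_zw : injective (fun i : 'I_h => w * z ^+ i).
  move=> i j /(mulfI w_neq0)/eqP; rewrite (eq_prim_root_expr z_prim).
  by rewrite !modn_small // => /eqP/val_inj.
rewrite -(card_imset _ inj_zw); apply: eq_card => x; rewrite inE.
apply/eqP/imsetP => [xE|[i _ ->]]; last first.
  by rewrite exprMn exprAC (prim_expr_order z_prim) expr1n mulr1.
have /(prim_rootP z_prim)[i xi] : (x / w) ^+ h = 1.
  by rewrite expr_div_n xE divff // expf_neq0.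
by exists i => //; rewrite -xi mulrC divfK.
Qed.

Lemma card_sqr_split (T : finType) (F : fieldType) (P : pred T) (f : T -> F)
    (b : F) :
  b != - b ->
  (#|[set x | P x && (f x == b)]| + #|[set x | P x && (f x == - b)]|)%N
    = #|[set x | P x && (f x ^+ 2 == b ^+ 2)]|.
Proof.
move=> neq_b.
rewrite -[RHS](cardsID [set x | f x == b]); congr (_ + _)%N; apply: eq_card => x.
  by rewrite !inE eqf_sqr; case: (f x == b); rewrite ?andbF ?andbT.
rewrite !inE eqf_sqr; case: (altP (f x =P b)) => [->|_] //=.
by rewrite (negbTE neq_b) !andbF.
Qed.

(** * Lines over the subfield of order q = n + 1 *)

Section Lines.

Variables (F : finFieldType) (n : nat).
Hypotheses (n_gt0 : (0 < n)%N) (charF : [pchar F].-nat n.+1).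

(** Both equations rearrange beta x + 1 = gamma (x + 1), the two sides being
    x ^ q + 1 and (x + 1) ^ q. *)
Lemma line_shift (x beta gamma : F) :
  x ^+ n = beta -> (x + 1) ^+ n = gamma ->
  x * (beta - gamma) = gamma - 1 /\ (x + 1) * (beta - gamma) = beta - 1.
Proof.
move=> xb xc.
have key : x * beta + 1 = (x + 1) * gamma.
  by rewrite -xb -xc -!exprS exprDn_pchar // expr1n.
have e1 : x * (beta - gamma) = gamma - 1.
  rewrite mulrBr; apply/eqP; rewrite subr_eq addrAC eq_sym subr_eq key.
  by rewrite mulrDl mul1r addrC.
by split=> //; rewrite mulrDl e1 mul1r addrC addrA subrK.
Qed.

(** The factors x and x + 1 cancel in [line_shift]: a nonzero n-th power forces
    each of them to be nonzero. *)
Lemma line_shift_eq (x beta gamma : F) :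
  beta != 0 -> gamma != 0 -> x ^+ n = beta -> (x + 1) ^+ n = gamma ->
  [/\ (beta == 1) = (beta == gamma) & (gamma == 1) = (beta == gamma)].
Proof.
move=> b0 c0 xb xc; have [e1 e2] := line_shift xb xc.
have x0 : x != 0.
  by apply: contraNneq b0 => x0; rewrite -xb x0 expr0n gtn_eqF.
have y0 : x + 1 != 0.
  by apply: contraNneq c0 => y0; rewrite -xc y0 expr0n gtn_eqF.
split.
  by rewrite -subr_eq0 -e2 mulf_eq0 (negbTE y0) subr_eq0.
by rewrite -subr_eq0 -e1 mulf_eq0 (negbTE x0) subr_eq0.
Qed.

(** [line_shift] determines x.  The value it gives is a solution because beta
    and gamma have norm 1, the norm being the power q + 1: raising to the power
    q conjugates the quotient by inverting beta and gamma in it. *)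
Lemma card_line_shift (beta gamma : F) :
  beta ^+ n.+2 = 1 -> gamma ^+ n.+2 = 1 ->
  beta != 1 -> gamma != 1 -> beta != gamma ->
  #|[set x : F | (x ^+ n == beta) && ((x + 1) ^+ n == gamma)]| = 1%N.
Proof.
move=> normb normc b1 c1 neq_bc.
have unit_of_norm (c : F) : c ^+ n.+2 = 1 -> c != 0.
  by move=> cn; apply: contra_eq_neq cn => ->; rewrite expr0n eq_sym oner_neq0.
have b0 := unit_of_norm _ normb; have c0 := unit_of_norm _ normc.
have frobV (c : F) : c != 0 -> c ^+ n.+2 = 1 -> c ^+ n.+1 = c^-1.
  by move=> cn0 cn; apply: (mulfI cn0); rewrite -exprS cn divff.
have d0 : beta - gamma != 0 by rewrite subr_eq0.
have frobB (c d : F) : (c - d) ^+ n.+1 = c ^+ n.+1 - d ^+ n.+1.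
  apply/eqP; rewrite eq_sym subr_eq -exprDn_pchar //; by rewrite subrK.
have pow_n (x c : F) : x != 0 -> x ^+ n.+1 = x * c -> x ^+ n = c.
  by move=> x0 xE; apply: (mulfI x0); rewrite -exprS.
apply/eqP/cards1P; exists ((gamma - 1) / (beta - gamma)); apply/setP => x.
rewrite !inE; apply/andP/eqP => [[/eqP xb /eqP xc]|->].
  by have [<- _] := line_shift xb xc; rewrite mulfK.
have yE : (gamma - 1) / (beta - gamma) + 1 = (beta - 1) / (beta - gamma).
  by rewrite -[X in _ + X](divff d0) -mulrDl; congr (_ / _); rewrite addrC addrA subrK.
have frob_quot (c : F) : c != 0 -> c ^+ n.+2 = 1 ->
    ((c - 1) / (beta - gamma)) ^+ n.+1
      = (c - 1) / (beta - gamma) * (beta * gamma / c).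
  move=> cn0 cn; rewrite expr_div_n !frobB expr1n !frobV //.
  by field; rewrite b0 c0 cn0 d0 mulN1r subr_eq0 eq_sym.
rewrite yE; split; apply/eqP; apply: pow_n.
- by rewrite mulf_neq0 ?invr_eq0 // subr_eq0.
- by rewrite frob_quot // mulfK.
- by rewrite mulf_neq0 ?invr_eq0 // subr_eq0.
- by rewrite frob_quot // [beta * gamma]mulrC mulfK.
Qed.

End Lines.

(** * Quadratic residues *)

Section QuadraticResidues.

Variables (F : finFieldType) (h : nat).
Hypotheses (h_gt0 : (0 < h)%N).

Local Notation N a b := (@shifted_power_count F h a%R b%R).

(** The involution x |-> 1 / x preserves the condition x ^ h = -1, and turns
    x + 1 into (x + 1) / x, whose h-th power has the opposite sign. *)
Lemma shifted_power_countV : N (-1) 1 = N (-1) (-1).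
Proof.
rewrite /shifted_power_count -(card_imset _ (inv_inj (@invrK F))).
rewrite (can2_imset_pre _ (@invrK F) (@invrK F)); apply: eq_card => x.
rewrite !inE exprVn (can2_eq (@invrK F) (@invrK F)) invrN1.
case: eqP => //= xh; have x0 : x != 0.
  apply: contra_eq_neq xh => ->.
  by rewrite expr0n gtn_eqF //= eq_sym oppr_eq0 oner_neq0.
have -> : x^-1 + 1 = (x + 1) / x by rewrite mulrDl divff // mul1r addrC.
by rewrite expr_div_n xh invrN1 mulrN1 eqr_oppLR.
Qed.

(** The involution x |-> - 1 - x exchanges x and x + 1 up to sign. *)
Lemma shifted_power_countN (a b : F) :
  N a b = N ((-1) ^+ h * b) ((-1) ^+ h * a).
Proof.
have flipK : involutive (fun x : F => - 1 - x) by move=> x; rewrite subKr.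
rewrite /shifted_power_count -(card_imset _ (inv_inj flipK)).
rewrite (can2_imset_pre _ flipK flipK); apply: eq_card => x.
rewrite !inE.
have signK (c d : F) : ((-1) ^+ h * c == d) = (c == (-1) ^+ h * d).
  by apply/eqP/eqP => [<-|->]; rewrite signrMK.
have -> : -1 - x + 1 = - x by rewrite addrAC addNr add0r.
have {1}-> : -1 - x = - (x + 1) by rewrite opprD addrC.
by rewrite (exprNn x) (exprNn (x + 1)) !signK andbC.
Qed.

(** If x ^ h = w ^ h = 1 or -1 then x is in the subfield of order q, hence so is
    x + 1, and (x + 1) ^ h is 1 or -1 unless x = -1. *)
Lemma shifted_power_count_row (z w : F) :
  [pchar F].-nat h.*2.+1 -> (1 : F) != -1 -> h.-primitive_root z ->
  w ^+ h.*2 = 1 ->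
  (N (w ^+ h) 1 + N (w ^+ h) (-1) + ((-1) ^+ h == w ^+ h))%N = h.
Proof.
move=> charF neq1 z_prim w2h.
have w0 : w != 0.
  apply: contra_eq_neq w2h => ->.
  by rewrite expr0n double_eq0 gtn_eqF //= eq_sym oner_neq0.
rewrite /shifted_power_count (card_sqr_split _ (fun x => (x + 1) ^+ h)) //.
rewrite -[RHS](card_expr_eq z_prim w0) [RHS](cardsD1 (-1)) inE addnC.
congr (_ + _)%N.
apply: eq_card => x; rewrite !inE andbC expr1n -exprM muln2.
case: (x ^+ h =P w ^+ h) => [xh|_]; last by rewrite !andbF.
rewrite !andbT -addr_eq0; have frobx : (x + 1) ^+ h.*2.+1 = x + 1.
  rewrite exprDn_pchar // expr1n exprS -muln2 exprM xh -exprM muln2 w2h.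
  by rewrite mulr1.
case: (eqVneq (x + 1) 0) => [->|y0] /=.
  by rewrite expr0n double_eq0 gtn_eqF //= eq_sym oner_eq0.
by apply/eqP/(mulfI y0); rewrite -exprS frobx mulr1.
Qed.

End QuadraticResidues.

(** * Counting in a field of order q ^ 2, with q = 2 h + 1 *)

Section QuadraticExtension.

Variables (F : finFieldType) (h : nat) (z : F).
Hypothesis h_gt0 : (0 < h)%N.
Local Notation e := (h.*2.+2).
Hypothesis z_prim : (2 * e * h).-primitive_root z.

Local Notation N a b := (@shifted_power_count F h a%R b%R).
Local Notation a_ i := (z ^+ (i * h)).

Lemma prim_root_half : z ^+ (e * h) = -1.
Proof.
have /eqP := prim_expr_order z_prim.
rewrite -mulnA mulnC exprM sqrf_eq1 => /orP[|/eqP//].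
rewrite -(prim_order_dvd z_prim) => /dvdn_leq; lia.
Qed.

Lemma sign_neq1 : (1 : F) != -1.
Proof.
rewrite -prim_root_half eq_sym -(prim_order_dvd z_prim).
by apply/negP => /dvdn_leq; lia.
Qed.

Lemma power_neq0 i : a_ i != 0.
Proof.
apply/expf_neq0; apply: contra_eq_neq (prim_expr_order z_prim) => ->.
by rewrite expr0n gtn_eqF ?(prim_order_gt0 z_prim) // eq_sym oner_neq0.
Qed.

Lemma power_shift_half i : a_ (i + e) = - a_ i.
Proof. by rewrite mulnDl exprD prim_root_half mulrN1. Qed.

Lemma line_eq i j : (a_ i ^+ 2 == a_ j ^+ 2) = (i == j %[mod e])%N.
Proof.
rewrite -!exprM (eq_prim_root_expr z_prim).
have -> : (2 * e * h = e * (h * 2))%N by lia.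
by rewrite -!mulnA -!muln_modl eqn_pmul2r // muln_gt0 h_gt0.
Qed.

Lemma line_norm i : (a_ i ^+ 2) ^+ e = 1.
Proof.
rewrite -!exprM; have -> : (i * h * (2 * e) = 2 * e * h * i)%N by lia.
by rewrite exprM (prim_expr_order z_prim) expr1n.
Qed.

Hypothesis charF : [pchar F].-nat h.*2.+1.

(** [line_shift_eq] in terms of exponents: when two of i, j, 0 agree modulo e
    and the third does not, this excludes any solution. *)
Lemma shifted_power_count_lines (i j : nat) :
  N (a_ i) (a_ j) != 0%N ->
  [/\ (i == 0 %[mod e])%N = (i == j %[mod e])%N
    & (j == 0 %[mod e])%N = (i == j %[mod e])%N].
Proof.
rewrite -lt0n => /card_gt0P[x]; rewrite inE => /andP[/eqP xi /eqP xj].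
have a0 k : a_ k ^+ 2 != 0.
  by rewrite expf_neq0 ?power_neq0.
have [|||||e1 e2] := @line_shift_eq F h.*2 _ charF x (a_ i ^+ 2) (a_ j ^+ 2).
- by lia.
- exact: a0.
- exact: a0.
- by rewrite -xi -exprM muln2.
- by rewrite -xj -exprM muln2.
have one : 1 = a_ 0 ^+ 2 by rewrite mul0n expr0 expr1n.
by rewrite -!line_eq -one.
Qed.

(** Squaring merges the four sign choices into a single pair of lines, which
    [card_line_shift] handles. *)
Lemma shifted_power_count_signs (i j : nat) :
  i != j %[mod e] -> i != 0 %[mod e] -> j != 0 %[mod e] ->
  (N (a_ i) (a_ j) + N (a_ i) (- a_ j)
    + (N (- a_ i) (a_ j) + N (- a_ i) (- a_ j)))%N = 1%N.
Proof.
move=> ij i0 j0.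
have neqN k : a_ k != - a_ k.
  rewrite -mulrN1 -subr_eq0 -[X in X - _]mulr1 -mulrBr.
  by rewrite mulf_neq0 ?power_neq0 // subr_eq0 sign_neq1.
rewrite /shifted_power_count !(card_sqr_split _ (fun x => (x + 1) ^+ h)) //.
(* Exchange the two conditions, so that the splitting now acts on x ^ h. *)
under eq_finset do rewrite andbC.
rewrite [X in (_ + X)%N](_ : _ = #|[set x : F |
  ((x + 1) ^+ h ^+ 2 == a_ j ^+ 2) && (x ^+ h == - a_ i)]|); last first.
  by apply: eq_card => x; rewrite !inE andbC.
rewrite (card_sqr_split _ (fun x => x ^+ h)) //.
have one : 1 = a_ 0 ^+ 2 by rewrite mul0n expr0 expr1n.
rewrite -[RHS](@card_line_shift F h.*2 charF (a_ i ^+ 2) (a_ j ^+ 2)).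
- by apply: eq_card => x; rewrite !inE -!exprM muln2 andbC.
- exact: line_norm.
- exact: line_norm.
- by rewrite one line_eq.
- by rewrite one line_eq.
- by rewrite line_eq.
Qed.

Lemma residue_rows :
  (N 1 1 + N 1 (-1) + ~~ odd h = h)%N /\ (N (-1) 1 + N (-1) (-1) + odd h = h)%N.
Proof.
have zh_prim : h.-primitive_root (z ^+ (2 * e)).
  have := dvdn_prim_root z_prim (dvdn_mull (2 * e) (dvdnn h)).
  by rewrite mulnK.
have row := shifted_power_count_row h_gt0 charF sign_neq1 zh_prim.
have sgn1 : ((-1) ^+ h == 1 :> F) = ~~ odd h.
  by rewrite -signr_odd; case: odd; rewrite ?eqxx // eq_sym (negbTE sign_neq1).
have sgnN1 : ((-1) ^+ h == -1 :> F) = odd h.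
  by rewrite -signr_odd; case: odd; rewrite ?eqxx // (negbTE sign_neq1).
split.
  by have := row 1 (expr1n _ _); rewrite expr1n sgn1.
have := row (z ^+ e); rewrite -!exprM prim_root_half sgnN1; apply.
have -> : (e * h.*2 = 2 * e * h)%N by lia.
by rewrite (prim_expr_order z_prim).
Qed.

Lemma residue_counts_even : ~~ odd h ->
  [/\ N 1 1 = h./2.-1, N 1 (-1) = h./2, N (-1) 1 = h./2 & N (-1) (-1) = h./2].
Proof.
move=> h_even; have [r1 r2] := residue_rows.
have symm := shifted_power_countN h (1 : F) (-1).
have := shifted_power_countV F h_gt0.
move: symm r1 r2; rewrite -signr_odd (negbTE h_even) expr0 !mul1r /=.
by split; lia.
Qed.

Lemma residue_counts_odd : odd h ->
  [/\ N 1 1 = h./2, N 1 (-1) = h./2.+1, N (-1) 1 = h./2 & N (-1) (-1) = h./2].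
Proof.
move=> h_odd; have [r1 r2] := residue_rows.
have symm := shifted_power_countN h (1 : F) 1.
have := shifted_power_countV F h_gt0.
move: symm r1 r2; rewrite -signr_odd h_odd expr1 !mulr1 /=.
by split; lia.
Qed.

End QuadraticExtension.
End PowerClasses.

Lemma perm_eq_unit4 (a b c d : nat) :
  a + b + (c + d) = 1 -> perm_eq [:: a; b; c; d] [:: 1; 0; 0; 0].
Proof.
by case: a b c d => [|[|?]] [|[|?]] [|[|?]] [|[|?]]; rewrite ?addnS.
Qed.


Theorem proposition4p4 (p r : nat) (F : finFieldType) (alpha : {unit F})
    (p_prime : prime p) (p_odd : odd p) (r_gt0 : 0 < r)
    (cardF : #|F| = p ^ (2 * r))
    (alpha_gen : generator [set: {unit F}] alpha) :
  let e := p ^ r + 1 in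
  let cyc := cyclotomic_number alpha (2 * e) in
  [/\ p ^ r - 1 = 0 %[mod 4] ->
        [/\ cyc 0 0 = (p ^ r - 5) %/ 4,
            cyc 0 e = (p ^ r - 1) %/ 4,
            cyc e 0 = (p ^ r - 1) %/ 4
          & cyc e e = (p ^ r - 1) %/ 4],
      p ^ r - 1 = 2 %[mod 4] ->
        [/\ cyc 0 e = (p ^ r + 1) %/ 4,
            cyc 0 0 = (p ^ r - 3) %/ 4,
            cyc e 0 = (p ^ r - 3) %/ 4
          & cyc e e = (p ^ r - 3) %/ 4],
      forall i : nat, i < 2 * e -> i != 0 -> i != e ->
        [/\ cyc 0 i = 0, cyc i 0 = 0 & cyc i i = 0] /\
        [/\ cyc i e = 0, cyc e i = 0, cyc i (e + i) = 0 & cyc (e + i) i = 0]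
    & forall i j : nat, 1 <= i <= e - 1 -> 1 <= j <= e - 1 -> i != j ->
        perm_eq [:: cyc i j; cyc i (j + e); cyc (i + e) j; cyc (i + e) (j + e)]
                [:: 1; 0; 0; 0]].
Proof.
move=> e cyc.
have q_odd : odd (p ^ r) by rewrite oddX p_odd orbT.
have q_gt1 : 1 < p ^ r by rewrite -(exp1n r) ltn_exp2r // prime_gt1.
pose h := (p ^ r)./2.
have h_gt0 : 0 < h by rewrite /h; lia.
have qE : p ^ r = h.*2.+1 by rewrite /h; lia.
have charF : [pchar F]%R.-nat h.*2.+1.
  rewrite -qE pnatX; apply/orP; left; rewrite pnatE //.
  exact: card_finPcharP cardF p_prime.
have eE : e = h.*2.+2 by rewrite /e qE addn1.
have cardF1 : #|F|.-1 = 2 * e * h by rewrite cardF mulnC expnM qE eE; nia.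
have z_prim := generator_prim_root alpha_gen.
rewrite cardF1 eE in z_prim.
set z := val alpha in z_prim.
have cycE i j : cyc i j = shifted_power_count h (z ^+ (i * h))%R (z ^+ (j * h))%R.
  exact: cyclotomic_numberE.
have cyce : (z ^+ (e * h) = -1)%R by rewrite eE prim_root_half.
have vanish i j : ((i == 0 %[mod e]) != (i == j %[mod e]))
    || ((j == 0 %[mod e]) != (i == j %[mod e])) -> cyc i j = 0.
  move=> neq_ij; apply/eqP; apply: contraTT neq_ij; rewrite cycE eE.
  by case/(shifted_power_count_lines h_gt0 z_prim charF) => -> ->; rewrite eqxx.
split.
- move=> q4; have h_even : ~~ odd h by move: q4; rewrite qE; lia.
  have := residue_counts_even h_gt0 z_prim charF h_even.
  rewrite !cycE !cyce mul0n GRing.expr0 => -[-> -> -> ->].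
  by split; rewrite qE; lia.
- move=> q4; have h_odd : odd h by move: q4; rewrite qE; lia.
  have := residue_counts_odd h_gt0 z_prim charF h_odd.
  rewrite !cycE !cyce mul0n GRing.expr0 => -[-> -> -> ->].
  by split; rewrite qE; lia.
- move=> i i_lt i0 ie.
  have imod : (i %% e == 0) = false.
    by apply/negP => /dvdnP[[|[|k]] iE]; lia.
  have modi : (0 == i %% e) = false by rewrite eq_sym.
  by split; split; apply: vanish;
    rewrite ?modnDl ?modnn ?mod0n ?eqxx ?imod ?modi.
- move=> i j i_bd j_bd neq_ij; apply: perm_eq_unit4.
  rewrite !cycE eE !(power_shift_half h_gt0 z_prim).
  by apply: shifted_power_count_signs; rewrite // ?mod0n !modn_small //; lia.
Qed.
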